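(* Let $\beta$ be a real number with $|\beta|>1$ and $\mathcal A=\{m,m+1,\dots,0,\dots,M\}\subset\mathbb Z$, where $m\le0<M$ if $\beta>1$, and $m\le 0\le M$ if $\beta<-1$. If $|\beta|<\#\mathcal A=M-m+1$, then multiplication and division in $(\beta,\mathcal A)$ are on-line performable by the Trivedi–Ercegovac algorithms, i.e.: (i) there exist an integer $\delta\ge1$ and a function $\mathrm{Select_M}:\mathbb R\to\mathcal A$ such that for all admissible inputs the sequence $(W_k)$ of the on-line multiplication algorithm is bounded and $\sum_{j\ge1}p_j\beta^{-j}=XY$; (ii) for every $D_{\min}>0$ there exist an integer $\delta\ge1$ and a function $\mathrm{Select_D}:\mathbb R\times\mathbb R\to\mathcal A$ such that for all admissible inputs of the on-line division algorithm the sequence $(W_k)$ is bounded and $\sum_{j\ge1}q_j\beta^{-j}=N/D$.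
   Context: On-line multiplication algorithm (delay $\delta$, function $\mathrm{Select_M}$): inputs are sequences $(x_j)_{j\ge1},(y_j)_{j\ge1}$ in $\mathcal A$ with $x_1=\dots=x_\delta=y_1=\dots=y_\delta=0$; $X=\sum_j x_j\beta^{-j}$, $Y=\sum_j y_j\beta^{-j}$, $X_k,Y_k$ partial sums up to $k$. Set $W_0=X_0=Y_0=p_0=0$, and for $k\ge1$: $W_k=\beta(W_{k-1}-p_{k-1})+(x_kY_{k-1}+y_kX_k)$, $p_k=\mathrm{Select_M}(W_k)$. On-line division algorithm (delay $\delta$, $D_{\min}>0$, function $\mathrm{Select_D}$): inputs are sequences $(n_j)_{j\ge1},(d_j)_{j\ge1}$ in $\mathcal A$ with $n_1=\dots=n_\delta=0$ and $|D_k|\ge D_{\min}$ for all $k\ge1$, where $D_k=\sum_{j=1}^kd_j\beta^{-j}$; $N=\sum_jn_j\beta^{-j}$, $D=\sum_jd_j\beta^{-j}$, $Q_k=\sum_{j=1}^kq_j\beta^{-j}$. Set $W_0=q_0=Q_0=0$ and for $k\ge1$: $W_k=\beta(W_{k-1}-q_{k-1}D_{k-1+\delta})+(n_{k+\delta}-Q_{k-1}d_{k+\delta})\beta^{-\delta}$, $q_k=\mathrm{Select_D}(W_k,D_{k+\delta})$. *)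

(* Defs.v *)
From HB Require Import structures.
From mathcomp Require Export all_boot all_order all_algebra.
From mathcomp Require Export all_classical all_reals all_analysis.
Export Order.TTheory GRing.Theory Num.Theory.
Export numFieldNormedType.Exports.

Set Implicit Arguments.
Unset Strict Implicit.
Unset Printing Implicit Defensive.

Local Open Scope classical_set_scope.
Local Open Scope ring_scope.

Definition alphabet (m M : int) : set int := [set z | m <= z <= M].

(* Digit strings are indexed from 1: the value at index 0 is never constrained
   and never contributes to a partial sum. *)
Definition digit_seq (m M : int) (a : nat -> int) : Prop :=
  forall j : nat, (1 <= j)%N -> alphabet m M (a j).

Definition zero_upto (delta : nat) (a : nat -> int) : Prop :=
  forall j : nat, (1 <= j <= delta)%N -> a j = 0.

Section Numeration.
Context {R : realType}.
Variable beta : R.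

Definition psum (a : nat -> int) (k : nat) : R :=
  \sum_(1 <= j < k.+1) (a j)%:~R * beta ^- j.

(* [lim] is a total operator; the limit exists whenever [1 < `|beta|] and the
   digits of [a] lie in a finite alphabet. *)
Definition value (a : nat -> int) : R := lim (psum a @ \oo).

Section Multiplication.
Variables (SelectM : R -> int) (x y : nat -> int).

Definition mul_select (k : nat) (w : R) : int :=
  if k is 0%N then 0 else SelectM w.

Fixpoint mulW (k : nat) : R :=
  if k is k'.+1 then
    beta * (mulW k' - (mul_select k' (mulW k'))%:~R)
    + ((x k)%:~R * psum y k' + (y k)%:~R * psum x k)
  else 0.

Definition mulp (k : nat) : int := mul_select k (mulW k).

Lemma mulW0 : mulW 0 = 0. Proof. by []. Qed.

Lemma mulp0 : mulp 0 = 0. Proof. by []. Qed.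

Lemma mulWS k : mulW k.+1 = beta * (mulW k - (mulp k)%:~R)
  + ((x k.+1)%:~R * psum y k + (y k.+1)%:~R * psum x k.+1).
Proof. by []. Qed.

Lemma mulpS k : mulp k.+1 = SelectM (mulW k.+1). Proof. by []. Qed.

End Multiplication.

Section Division.
Variables (delta : nat) (SelectD : R -> R -> int) (n d : nat -> int).

(* The state after step k is the triple (W_k, q_k, Q_k). *)
Fixpoint div_state (k : nat) : R * int * R :=
  if k is k'.+1 then
    let: (w, q, Q) := div_state k' in
    let w' := beta * (w - q%:~R * psum d (k' + delta))
      + ((n (k + delta))%:~R - Q * (d (k + delta))%:~R) * beta ^- delta in
    let q' := SelectD w' (psum d (k + delta)) in
    (w', q', Q + q'%:~R * beta ^- k)
  else (0, 0, 0).

Definition divW (k : nat) : R := (div_state k).1.1.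

Definition divq (k : nat) : int := (div_state k).1.2.

Lemma divW0 : divW 0 = 0. Proof. by []. Qed.

Lemma divq0 : divq 0 = 0. Proof. by []. Qed.

Lemma div_stateQ k : (div_state k).2 = psum divq k.
Proof.
rewrite /psum; elim: k => [|k IHk]; first by rewrite big_geq.
rewrite big_nat_recr //= -IHk /divq /=.
by case: (div_state k) => [[w q] Q].
Qed.

Lemma divWS k : divW k.+1 =
  beta * (divW k - (divq k)%:~R * psum d (k + delta))
  + ((n (k.+1 + delta))%:~R - psum divq k * (d (k.+1 + delta))%:~R)
    * beta ^- delta.
Proof.
by rewrite -div_stateQ /divW /divq /=; case: (div_state k) => [[w q] Q].
Qed.

Lemma divqS k : divq k.+1 = SelectD (divW k.+1) (psum d (k.+1 + delta)).
Proof. by rewrite /divW /divq /=; case: (div_state k) => [[w q] Q]. Qed.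

End Division.

End Numeration.

(* Main.v *)
(* Let [B = |beta|].  Since [B < M - m + 1], there are an interval [[a, b]] and a
   margin [eps > 0] such that every [w] in [[a, b]] admits a digit [z] of the
   alphabet with [beta * (w - z)] in [[a + eps, b - eps]]: the admissible [w] for
   consecutive digits overlap, and the extreme digits take care of the ends.
   For both algorithms [W_k] (divided by the current divisor for the division)
   is an orbit of [w |-> beta * (w - z)] up to a perturbation of order [B^-delta],
   hence it stays bounded for large [delta].  The closed form
   [W_(k+1) = beta^(k+1) (X_(k+1) Y_(k+1) - P_k)], respectively
   [W_(k+1) = beta^(k+1) (N_(k+1+delta) - Q_k D_(k+1+delta))], then gives
   convergence.

   If [beta > 1] and [m = 0], the interval has [a > 0], so the orbit does not
   start in it.  Then the digit [0] is selected below [a]; as long as no other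
   digit has been output, the closed form shows that [W_k >= 0], so the orbit
   remains in [[0, a[] until it enters [[a, b]]. *)
Require Import Defs.
From mathcomp Require Import ring lra zify.

Set Implicit Arguments.
Unset Strict Implicit.
Unset Printing Implicit Defensive.

Local Open Scope classical_set_scope.
Local Open Scope ring_scope.

(** * Digit selection and stable orbits *)

Lemma int_multiple_between (R : realType) (m M : int) (B lo hi : R) :
  0 < B -> m <= M -> lo <= B * M%:~R -> B * m%:~R <= hi -> lo + B <= hi ->
  exists z : int, m <= z <= M /\ lo <= B * z%:~R <= hi.
Proof.
move=> B0 mM loM mhi lohi.
have [Mhi|hiM] := leP (B * M%:~R) hi.
  by exists M; rewrite lexx mM loM Mhi.
have /andP[fl fu] := floor_itv (hi / B).
rewrite ler_pdivlMr // in fl; rewrite ltr_pdivrMr // intrD in fu.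
exists (Num.floor (hi / B)); split.
  rewrite floor_ge_int ler_pdivlMr // mulrC mhi /=.
  rewrite -(ler_int R) -(ler_pM2r B0); lra.
by apply/andP; split; lra.
Qed.

Lemma selection_interval (R : realType) (beta : R) (m M : int) :
  1 < `|beta| ->
  (1 < beta -> m <= 0 /\ 0 < M) -> (beta < -1 -> m <= 0 /\ 0 <= M) ->
  `|beta| < (M - m + 1)%:~R ->
  exists a b eps : R,
  [/\ 0 < eps,
      a <= - eps /\ eps <= b \/
        [/\ 1 < beta, m = 0, 0 < a, eps <= b & beta * a + eps <= b] &
      forall w, a <= w <= b -> exists z : int,
        m <= z <= M /\ a + eps <= beta * (w - z%:~R) <= b - eps].
Proof.
set B := `|beta| => B1 hpos hneg; rewrite !intrD intrN => hc.
(* The first bound is the slack in the cardinality hypothesis and gives [width]; the second,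
   [(B + 1) * eps <= 1], places the endpoints relative to 0. *)
pose eps := Num.min ((M%:~R - m%:~R + 1%:~R - B) / 2) (B + 1)^-1.
have Bp : 0 < B + 1 by lra.
have e0 : 0 < eps by rewrite lt_min invr_gt0 Bp andbT; lra.
have ec : 2 * eps <= M%:~R - m%:~R + 1%:~R - B.
  have : eps <= (M%:~R - m%:~R + 1%:~R - B) / 2 by rewrite ge_min lexx.
  lra.
have eB : (B + 1) * eps <= 1.
  by rewrite mulrC -ler_pdivlMr // div1r ge_min lexx orbT.
clearbody eps.
(* The values [beta * (w - z)] for consecutive [z] are [B] apart, so a target interval of length at
   least [B] cannot be skipped. Both signs of [beta] give this equation. *)
have width (a b : R) :
    (b - a) * (B - 1) = B * (M%:~R - m%:~R) - 2 * eps -> B <= b - a - 2 * eps.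
  move=> ab; have Bm1 : 0 < B - 1 by lra.
  have bw := ler_wpM2l (ltW (lt_trans ltr01 B1)) ec.
  by rewrite -(ler_pM2r Bm1); lra.
move: B1; rewrite /B lter_normr => /orP[b1|bN1].
  have [m0 M0] := hpos b1.
  have BE : B = beta by rewrite /B ger0_norm; lra.
  have MR : 1 <= M%:~R :> R by rewrite ler1z -gtz0_ge1.
  have b1' : beta - 1 != 0 by rewrite subr_eq0 gt_eqF.
  (* Endpoints solving [beta * (a - m) = a + eps] and [beta * (b - M) = b - eps]: the extreme digits
     are just good enough at the ends. *)
  pose a := (beta * m%:~R + eps) / (beta - 1).
  pose b := (beta * M%:~R - eps) / (beta - 1).
  have aE : a * (beta - 1) = beta * m%:~R + eps by rewrite /a; field.
  have bE : b * (beta - 1) = beta * M%:~R - eps by rewrite /b; field.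
  clearbody a b; rewrite {}BE in eB width; clear hneg hpos hc ec.
  have bm1 : 0 < beta - 1 by lra.
  exists a, b, eps; split=> //.
    have eb : eps <= b by rewrite -(ler_pM2r bm1); nra.
    move: m0; rewrite le_eqVlt => /predU1P[mE|mlt]; [right|left].
      rewrite mE mulr0 add0r in aE; split=> //.
        by rewrite -(ltr_pM2r bm1) aE mul0r.
      rewrite -(ler_pM2r bm1) bE mulrDl -mulrA aE; nra.
    split=> //; rewrite -(ler_pM2r bm1) aE.
    have mR : m%:~R <= -1 :> R by rewrite -(mulrN1z 1) ler_int; clear -mlt; lia.
    nra.
  move=> w /andP[aw wb].
  have aw' : beta * a <= beta * w by rewrite ler_pM2l //; lra.
  have wb' : beta * w <= beta * b by rewrite ler_pM2l //; lra.
  have /width wd : (b - a) * (beta - 1) = beta * (M%:~R - m%:~R) - 2 * eps.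
    by rewrite mulrBl aE bE; ring.
  have [] := @int_multiple_between R m M beta
      (beta * w - b + eps) (beta * w - a - eps);
    try (clear -m0 M0; lia); try lra.
  move=> z [zA /andP[z1 z2]].
  by exists z; split=> //; apply/andP; split; lra.
have bN : beta < -1 by lra.
have [m0 M0] := hneg bN.
have BE : B = - beta by rewrite /B ltr0_norm; lra.
have bE' : beta = - B by lra.
have B1 : 1 < B by lra.
rewrite {}bE'; clearbody B.
have BB : 0 < B * B - 1 by nra.
have mR : m%:~R <= 0 :> R by rewrite lerz0.
have MR : 0 <= M%:~R :> R by rewrite ler0z.
(* Either [m] or [M] may be 0 here, but not both: the integer [M - m] exceeds [B - 1 > 0]. *)
have mMR : 1 <= M%:~R - m%:~R :> R.
  have : (0 : R) < (M - m)%:~R by rewrite intrD intrN; lra.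
  by rewrite ltr0z gtz0_ge1 -(ler1z R) intrD intrN.
have mM1 : B * m%:~R - M%:~R <= -1.
  have := ler_wnM2r mR (ltW B1); lra.
have mM2 : m%:~R - B * M%:~R <= -1.
  have := ler_wpM2r MR (ltW B1); lra.
(* For negative [beta] the map reverses order, so the ends are exchanged: [beta * (a - m) = b - eps]
   and [beta * (b - M) = a + eps]. *)
pose a := (B * (B * m%:~R + eps) - (B * M%:~R - eps)) / (B * B - 1).
pose b := (B * (B * M%:~R - eps) - (B * m%:~R + eps)) / (B * B - 1).
have BB0 : B * B - 1 != 0 by rewrite gt_eqF.
have abE : B * a + b = B * m%:~R + eps by rewrite /a /b; field.
have baE : B * b + a = B * M%:~R - eps by rewrite /a /b; field.
have aE : a * (B * B - 1) = B * (B * m%:~R + eps) - (B * M%:~R - eps).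
  by rewrite /a; field.
have bE : b * (B * B - 1) = B * (B * M%:~R - eps) - (B * m%:~R + eps).
  by rewrite /b; field.
clearbody a b; clear hneg hpos hc ec.
exists a, b, eps; split=> //.
  left; split; rewrite -(ler_pM2r BB) ?aE ?bE -subr_ge0.
    have -> : - eps * (B * B - 1) - (B * (B * m%:~R + eps) - (B * M%:~R - eps))
       = B * (M%:~R - B * m%:~R - (B + 1) * eps) by ring.
    by apply: mulr_ge0; lra.
  have -> : B * (B * M%:~R - eps) - (B * m%:~R + eps) - eps * (B * B - 1)
       = B * (B * M%:~R - m%:~R - (B + 1) * eps) by ring.
  by apply: mulr_ge0; lra.
move=> w /andP[aw wb].
have aw' : B * a <= B * w by rewrite ler_pM2l //; lra.
have wb' : B * w <= B * b by rewrite ler_pM2l //; lra.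
have /width wd : (b - a) * (B - 1) = B * (M%:~R - m%:~R) - 2 * eps.
  by rewrite mulrBr; lra.
have [] := @int_multiple_between R m M B
      (B * w + a + eps) (B * w + b - eps); try (clear -m0 M0; lia); try lra.
move=> z [zA /andP[z1 z2]].
by exists z; split=> //; apply/andP; split; lra.
Qed.

(* [S] keeps every orbit of [w |-> beta * (w - S w)] started at [0] in
   [[-K, K]] under perturbations of size at most [eps].  When [beta > 1] and
   [m = 0] the value [0] is an endpoint of the representable interval, and the
   orbit must in addition stay nonnegative until its first nonzero digit. *)
Definition stabilizing (R : realType) (beta : R) (m : int) (S : R -> int)
    (K eps : R) : Prop :=
  forall (w : nat -> R) (s : nat -> int),
    w 0%N = 0 -> s 0%N = 0 -> (forall k, s k.+1 = S (w k.+1)) ->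
    (forall k, `|w k| <= K -> `|w k.+1 - beta * (w k - (s k)%:~R)| <= eps) ->
    (1 < beta -> m = 0 -> forall k, zero_upto k s -> 0 <= w k.+1) ->
    forall k, `|w k| <= K.

Lemma stabilizing_selection (R : realType) (beta : R) (m M : int) :
  1 < `|beta| ->
  (1 < beta -> m <= 0 /\ 0 < M) -> (beta < -1 -> m <= 0 /\ 0 <= M) ->
  `|beta| < (M - m + 1)%:~R ->
  exists (S : R -> int) (K eps : R),
  [/\ 0 < eps, forall w, alphabet m M (S w) & stabilizing beta m S K eps].
Proof.
move=> b1 hpos hneg hc.
have m0M : m <= 0 <= M.
  move: (b1); rewrite lter_normr => /orP[/hpos[-> /ltW]//|bN].
  by have [|-> ->] := hneg; first lra.
have [a [b [eps [e0 ends sel]]]] := selection_interval b1 hpos hneg hc.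
have [w|S SP] := @choice R int (fun w z => [/\ alphabet m M z,
    a <= w <= b -> a + eps <= beta * (w - z%:~R) <= b - eps & w < a -> z = 0]).
  have [wab|nwab] := boolP (a <= w <= b).
    have [z [zA zw]] := sel w wab; exists z; split=> // wa.
    by case/andP: wab => aw _; rewrite ltNge aw in wa.
  by exists 0; split=> //.
pose K := Num.max `|a| `|b|.
have abK w : a <= w <= b -> `|w| <= K.
  move=> /andP[aw wb]; rewrite /K le_max !ler_norml.
  have := ler_norm a; have := ler_norm (- a); rewrite normrN.
  have := ler_norm b; have := ler_norm (- b); rewrite normrN.
  have [w0|w0] := leP 0 w => *; apply/orP; [right|left]; apply/andP; split; lra.
have aK : `|a| <= K by rewrite le_max lexx.
have K0 : 0 <= K by apply: le_trans aK.
exists S, K, eps; split=> // [w|w s w0 s0 sS err pos]; first by case: (SP w).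
(* The second alternative is the waiting phase: only zeros have been output and the orbit is still
   below [a]. *)
pose inv k := a <= w k.+1 <= b \/
  [/\ 1 < beta, m = 0, zero_upto k s & 0 <= w k.+1 < a].
have invK k : inv k -> `|w k.+1| <= K.
  case=> [/abK//|[_ _ _ /andP[w1 w2]]]; rewrite ger0_norm //.
  by apply: le_trans aK; apply: le_trans (ltW w2) (ler_norm _).
suff H k : inv k by case=> [|k]; [rewrite w0 normr0 | exact: invK].
elim: k => [|k IHk].
  have := err 0%N; rewrite w0 s0 normr0 subrr mulr0 subr0 => /(_ K0).
  rewrite ler_norml => /andP[we1 we2].
  case: ends => [[ea eb]|[b1' m0 a0 eb _]].
    by left; apply/andP; split; lra.
  have z0 : zero_upto 0 s by case.
  have w1 := pos b1' m0 0%N z0; rewrite /inv.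
  have [aw|wa] := leP a (w 1%N); first by left; rewrite (le_trans we2).
  by right; rewrite w1.
have := err k.+1 (invK k IHk); rewrite ler_norml => /andP[we1 we2].
have [_ Sin Slt] := SP (w k.+1).
case: IHk => [wab|[b1' m0 z0 /andP[wk0 wka]]].
  move/andP: (Sin wab); rewrite -sS => -[h1 h2].
  by left; apply/andP; split; lra.
have sk0 : s k.+1 = 0 by rewrite sS Slt.
have zS : zero_upto k.+1 s.
  move=> j /andP[j1]; rewrite leq_eqVlt => /predU1P[->//|jk].
  by apply: z0; rewrite j1.
have w1 := pos b1' m0 k.+1 zS; rewrite /inv.
have [aw|wa] := leP a (w k.+2); last by right; rewrite w1.
left; case: ends => [[ea eb]|[_ _ _ _ eb]]; first by lra.
(* On leaving the waiting phase the orbit cannot jump over [[a, b]], since [beta * a + eps <= b]. *)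
have : beta * w k.+1 <= beta * a by rewrite ler_pM2l ?ltW //; lra.
by move: we2; rewrite sk0 subr0; lra.
Qed.

(** * Bounds and convergence of partial sums *)

Lemma digit_norm_le (R : realType) (m M : int) (a : nat -> int) j :
  m <= 0 <= M -> digit_seq m M a -> (1 <= j)%N ->
  `|(a j)%:~R| <= (M - m)%:~R :> R.
Proof.
move=> mM aA j1; rewrite -intr_norm ler_int.
by have /andP[mj jM] := aA j j1; lia.
Qed.

Section PartialSums.
Variables (R : realType) (beta : R).
Hypothesis beta1 : 1 < `|beta|.

Lemma psum0 (a : nat -> int) : psum beta a 0 = 0.
Proof. by rewrite /psum big_geq. Qed.

Lemma psumS (a : nat -> int) k :
  psum beta a k.+1 = psum beta a k + (a k.+1)%:~R * beta ^- k.+1.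
Proof. by rewrite /psum big_nat_recr. Qed.

Lemma psum_eq0 (a : nat -> int) delta k :
  zero_upto delta a -> (k <= delta)%N -> psum beta a k = 0.
Proof.
move=> a0 kd; rewrite /psum big_nat_cond big1 // => j /andP[/andP[j1 jk] _].
by rewrite a0 ?mul0r // j1; apply: leq_trans kd.
Qed.

Lemma psum_ge0 (M : int) (a : nat -> int) k :
  0 < beta -> digit_seq 0 M a -> 0 <= psum beta a k.
Proof.
move=> b0 aA; elim: k => [|k IHk]; first by rewrite psum0.
rewrite psumS; apply: addr_ge0 => //; apply: mulr_ge0.
  by rewrite ler0z; case/andP: (aA k.+1 isT).
by rewrite invr_ge0 exprn_ge0 // ltW.
Qed.

Lemma psum_norm_le (m M : int) (a : nat -> int) delta k :
  m <= 0 <= M -> digit_seq m M a -> zero_upto delta a ->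
  `|psum beta a k| <= (M - m)%:~R * `|beta| ^- delta / (`|beta| - 1).
Proof.
move=> mM aA a0; set B := `|beta|; set C := _%:~R.
have B1 : 1 < B := beta1.
have B0 : 0 < B by lra.
have C0 : 0 <= C by rewrite /C ler0z; lia.
have Bm0 : 0 < B - 1 by lra.
have [kd|dk] := leqP k delta.
  rewrite (psum_eq0 a0) // normr0 !mulr_ge0 ?invr_ge0 ?exprn_ge0 //; exact: ltW.
(* The exact finite geometric sum is the bound that passes through the induction. *)
apply: (@le_trans _ _ (C * (B ^- delta - B ^- k) / (B - 1))); last first.
  rewrite ler_pM2r ?invr_gt0 // ler_wpM2l // gerBl invr_ge0 exprn_ge0 //.
  exact: ltW.
rewrite -(subnKC (ltnW dk)); elim: (k - delta)%N => [|i IHi].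
  by rewrite addn0 (psum_eq0 a0) // normr0 subrr mulr0 mul0r.
rewrite addnS psumS; apply: le_trans (ler_normD _ _) _.
have aC : `|(a (delta + i).+1)%:~R| <= C by apply: digit_norm_le.
apply: le_trans (lerD IHi (_ : _ <= C * B ^- (delta + i).+1)) _.
  by rewrite normrM normrV ?unitfE ?expf_neq0 -?normr_gt0 // normrX
     ler_wpM2r // invr_ge0 exprn_ge0 // ltW.
rewrite le_eqVlt; apply/orP; left; apply/eqP.
rewrite [B ^+ (delta + i).+1]exprS; field.
by rewrite ?expf_neq0 ?gt_eqF.
Qed.

Lemma psum_cvg (m M : int) (a : nat -> int) :
  m <= 0 <= M -> digit_seq m M a -> psum beta a @ \oo --> value beta a.
Proof.
move=> mM aA.
(* [series] starts at index 0, where [a] is unconstrained; [u] puts 0 there. *)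
pose u (j : nat) : R := if j is 0%N then 0 else (a j)%:~R * beta ^- j.
have uE : psum beta a = [sequence series u n.+1]_n.
  apply/funext=> k; rewrite /psum seriesEnat /= [RHS]big_ltn // add0r.
  by apply: eq_big_nat => j /andP[j1 _]; case: j j1.
suff /cvg_ex[l ul] : cvgn (series u).
  suff : cvgn (psum beta a) by [].
  by apply/cvg_ex; exists l; rewrite uE cvg_shiftS.
apply: normed_cvg.
apply: (@series_le_cvg _ _ (geometric (M - m)%:~R `|beta|^-1)).
- by move=> n; exact: normr_ge0.
- by move=> n; rewrite mulr_ge0 ?ler0z ?exprn_ge0 ?invr_ge0 //; lia.
- move=> [|j] /=.
    by rewrite normr0 mulr_ge0 ?ler0z ?exprn_ge0 ?invr_ge0 //; lia.
  rewrite normrM normfV normrX -exprVn ler_wpM2r ?exprn_ge0 ?invr_ge0 //.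
  exact: digit_norm_le _ mM aA _.
- apply: is_cvg_geometric_series.
  by rewrite normfV normr_id invf_lt1 ?(lt_trans ltr01).
Qed.

Lemma expN_cvg0 : (fun k => beta ^- k) @ \oo --> (0 : R).
Proof.
have -> : (fun k => beta ^- k) = GRing.exp beta^-1.
  by apply/funext => k; rewrite exprVn.
by apply: cvg_expr; rewrite normfV invf_lt1 ?(lt_trans ltr01).
Qed.

Lemma ex_small_expN (K eps : R) : 0 < eps ->
  exists2 delta, (1 <= delta)%N & K * `|beta| ^- delta <= eps.
Proof.
move=> e0.
have /cvgr0Pnorm_le /(_ _ e0) [N _ HN] :
    (fun k => K * beta ^- k) @ \oo --> (0 : R).
  by rewrite -(mulr0 K); apply: cvgMr; exact: expN_cvg0.
exists N.+1 => //; have := HN N.+1 (leqnSn N) => /=.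
rewrite normrM normfV normrX; apply: le_trans.
by rewrite ler_wpM2r ?ler_norm // invr_ge0 exprn_ge0.
Qed.

Lemma bounded_mul_expN_cvg0 (u : nat -> R) (K : R) :
  (forall k, `|u k| <= K) -> (fun k => u k * beta ^- k) @ \oo --> (0 : R).
Proof.
move=> uK; apply/cvgr0Pnorm_le => e e0.
have /cvgr0Pnorm_le /(_ _ e0) [N _ HN] :
    (fun k => K * beta ^- k) @ \oo --> (0 : R).
  by rewrite -(mulr0 K); apply: cvgMr; exact: expN_cvg0.
exists N => // k /HN /=; apply: le_trans.
by rewrite !normrM ler_wpM2r // (le_trans (uK k)) ?ler_norm.
Qed.

End PartialSums.

(** * Closed forms of the residuals *)

(** The input term telescopes: [x_k Y_(k-1) + y_k X_k] is [beta^k (X_k Y_k - X_(k-1) Y_(k-1))]. *)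
Lemma mulW_residual (R : realType) (beta : R) (S : R -> int)
    (x y : nat -> int) k : beta != 0 ->
  mulW beta S x y k.+1 = beta ^+ k.+1 *
    (psum beta x k.+1 * psum beta y k.+1 - psum beta (mulp beta S x y) k).
Proof.
move=> b0; elim: k => [|k IHk].
  rewrite mulWS mulW0 mulp0 !psumS !psum0; field.
  by rewrite ?expf_neq0.
rewrite mulWS IHk (psumS _ (mulp _ _ _ _)) (psumS _ x k.+1) (psumS _ y k.+1).
rewrite !exprS; field.
by rewrite ?expf_neq0 // b0.
Qed.

(** The input term is [beta^k] times the increment of [N - Q_(k-1) D], both read [delta] places
    ahead. The zeros of [n] start the induction, as nothing read before step 1 enters [W]. *)
Lemma divW_residual (R : realType) (beta : R) delta (S : R -> R -> int)
    (n d : nat -> int) k : beta != 0 -> zero_upto delta n ->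
  divW beta delta S n d k.+1 = beta ^+ k.+1 *
    (psum beta n (k.+1 + delta) -
     psum beta (divq beta delta S n d) k * psum beta d (k.+1 + delta)).
Proof.
move=> b0 n0; elim: k => [|k IHk].
  rewrite divWS divW0 divq0 add1n !psumS !psum0 (psum_eq0 beta n0) //.
  rewrite !exprS; field.
  by rewrite ?expf_neq0 // b0.
rewrite divWS IHk (psumS _ (divq _ _ _ _ _)).
rewrite [(k.+2 + delta)%N]addSn (psumS _ n (k.+1 + delta)).
rewrite (psumS _ d (k.+1 + delta)).
rewrite !addSn !exprS exprD; field.
by rewrite ?expf_neq0 // b0.
Qed.

Lemma bounded_funP (R : realType) (u : nat -> R) (K : R) :
  (forall k, `|u k| <= K) -> bounded_fun u.
Proof.
move=> uK; exists K; split; first exact: num_real.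
by move=> L KL k _; apply: le_trans (uK k) (ltW KL).
Qed.

(** * The two on-line algorithms *)

Section OnLine.
Variables (R : realType) (beta : R) (m M : int).
Hypothesis beta1 : 1 < `|beta|.
Hypothesis mM : m <= 0 <= M.
Variables (S : R -> int) (K eps : R).
Hypothesis eps0 : 0 < eps.
Hypothesis SA : forall w, alphabet m M (S w).
Hypothesis S_stable : stabilizing beta m S K eps.

Let C : R := (M - m)%:~R.

Let C_ge0 : 0 <= C. Proof. by rewrite /C ler0z; lia. Qed.

Let beta_neq0 : beta != 0.
Proof. by rewrite -normr_gt0 (lt_trans ltr01). Qed.

Let normX_ge0 k : 0 <= `|beta| ^- k.
Proof. by rewrite invr_ge0 exprn_ge0. Qed.

Lemma online_multiplication : exists delta : nat, (1 <= delta)%N /\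
  forall x y : nat -> int, digit_seq m M x -> digit_seq m M y ->
    zero_upto delta x -> zero_upto delta y ->
    bounded_fun (mulW beta S x y) /\
    psum beta (mulp beta S x y) @ \oo --> value beta x * value beta y.
Proof.
(* Each of the two input products is a digit, at most [C], times a partial sum, at most
   [C / (B - 1) * B^-delta]. *)
have [delta d1 dP] := ex_small_expN beta1 (C * (C / (`|beta| - 1)) *+ 2) eps0.
exists delta; split=> // x y xA yA x0 y0.
have WK : forall k, `|mulW beta S x y k| <= K.
  apply: (S_stable (s := mulp beta S x y)) => // [k _|b1 m0 k p0].
    rewrite mulWS addrC addKr; apply: le_trans dP; rewrite mulr2n mulrDl.
    apply: le_trans (ler_normD _ _) _; rewrite !normrM; apply: lerD.
      rewrite -mulrA; apply: ler_pM => //.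
        exact: (digit_norm_le R mM xA (ltn0Sn k)).
      by apply: le_trans (psum_norm_le beta1 _ mM yA y0) _; rewrite mulrAC.
    rewrite -mulrA; apply: ler_pM => //.
      exact: (digit_norm_le R mM yA (ltn0Sn k)).
    by apply: le_trans (psum_norm_le beta1 _ mM xA x0) _; rewrite mulrAC.
  (* With no nonzero digit output, the residual is a power of [beta] times [X Y], and all input
     digits are nonnegative. *)
  rewrite mulW_residual // (psum_eq0 _ p0) // subr0.
  have b0 : 0 < beta by apply: lt_trans b1.
  rewrite m0 in xA yA.
  by rewrite !mulr_ge0 ?exprn_ge0 ?(psum_ge0 _ b0 xA) ?(psum_ge0 _ b0 yA) ?ltW.
split; first exact: bounded_funP WK.
have -> : psum beta (mulp beta S x y) = fun k =>
    psum beta x k.+1 * psum beta y k.+1 - mulW beta S x y k.+1 * beta ^- k.+1.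
  apply/funext => k; rewrite mulW_residual //; field.
  by rewrite expf_neq0.
rewrite -[value beta x * _]subr0; apply: cvgB; first apply: cvgM.
- by rewrite (cvg_shiftS (psum beta x)); exact: (psum_cvg beta1 mM xA).
- by rewrite (cvg_shiftS (psum beta y)); exact: (psum_cvg beta1 mM yA).
rewrite (cvg_shiftS (fun k => mulW beta S x y k * beta ^- k)).
exact: (bounded_mul_expN_cvg0 beta1 WK).
Qed.

Lemma online_division (Dmin : R) : 0 < Dmin ->
  exists delta : nat, (1 <= delta)%N /\
  forall n d : nat -> int, digit_seq m M n -> digit_seq m M d ->
    zero_upto delta n ->
    (forall k : nat, (1 <= k)%N -> Dmin <= `|psum beta d k|) ->
    bounded_fun (divW beta delta (fun w D => S (w / D)) n d) /\
    psum beta (divq beta delta (fun w D => S (w / D)) n d) @ \oo -->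
      value beta n / value beta d.
Proof.
move=> Dmin0; pose P : R := C / (`|beta| - 1).
have P0 : 0 <= P by rewrite /P divr_ge0 // subr_ge0 ltW.
(* The summands bound the digit of [n], the product of [Q_k] with a digit of [d], and the effect of
   replacing the divisor [D k] by [D k.+1]. *)
pose err : R := (C + P * C + `|beta| * (K + C) * C) / Dmin.
have [delta d1 dP] := ex_small_expN beta1 err eps0.
exists delta; split=> // n d nA dA n0 dmin.
pose Sel (w D : R) := S (w / D); rewrite -/Sel.
pose D k := psum beta d (k + delta).
pose W := divW beta delta Sel n d; pose q := divq beta delta Sel n d.
(* At [k = 0] this needs [delta >= 1]. *)
have Dge k : Dmin <= `|D k| by apply: dmin; rewrite addn_gt0 d1 orbT.
have D0 k : D k != 0 by rewrite -normr_gt0 (lt_le_trans Dmin0).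
(* This bounds the partial quotients by [P] before anything is known about [W]. *)
have qA : digit_seq m M q by case=> // k _; rewrite /q divqS; exact: SA.
have psumP (a : nat -> int) k : digit_seq m M a -> `|psum beta a k| <= P.
  move=> aA; apply: le_trans (psum_norm_le (delta := 0) beta1 k mM aA _) _.
    by case.
  by rewrite expr0 invr1 mulr1.
have qC k : `|(q k)%:~R| <= C :> R.
  case: k => [|k]; first by rewrite /q divq0 normr0.
  exact: (digit_norm_le R mM qA (ltn0Sn k)).
have wK k : `|W k / D k| <= K.
  move: k; apply: (S_stable (s := q)) => [|||k wK|b1 m0 k q0].
  - by rewrite /W divW0 mul0r.
  - by [].
  - by move=> k; rewrite /q divqS.
  - have DS : D k.+1 = D k + (d (k.+1 + delta)%N)%:~R * beta ^- (k.+1 + delta).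
      by rewrite /D addSn psumS.
    pose E : R := ((n (k.+1 + delta)%N)%:~R
       - psum beta q k * (d (k.+1 + delta)%N)%:~R) * beta ^- delta.
    (* The subtracted term is the cost of the changing divisor; it is small because [D k.+1 - D k]
       is a single digit at place [k.+1 + delta]. *)
    have -> : W k.+1 / D k.+1 - beta * (W k / D k - (q k)%:~R) =
        (E - beta * (W k / D k - (q k)%:~R) * (D k.+1 - D k)) / D k.+1.
      rewrite /W divWS -/W -/q -/(D k) -/E; field.
      by rewrite !D0.
    have kd : (0 < k.+1 + delta)%N by [].
    have nC := digit_norm_le R mM nA kd; have dC := digit_norm_le R mM dA kd.
    rewrite normrM normfV ler_pdivrMr ?normr_gt0 //.
    apply: (@le_trans _ _ (eps * Dmin)); last by rewrite ler_pM2l.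
    rewrite -ler_pdivrMr //; apply: le_trans dP; rewrite /err [leRHS]mulrAC.
    rewrite ler_pM2r ?invr_gt0 // mulrDl.
    apply: le_trans (ler_normB _ _) _; apply: lerD.
      rewrite /E normrM normfV normrX ler_wpM2r //.
      apply: le_trans (ler_normB _ _) _; apply: lerD => //.
      by rewrite normrM ler_pM // psumP.
    rewrite DS addrAC subrr add0r !normrM -!mulrA ler_wpM2l //.
    apply: ler_pM => //.
      by apply: le_trans (ler_normB _ _) _; apply: lerD.
    apply: ler_pM => //.
    rewrite normfV normrX lef_pV2 ?posrE ?exprn_gt0 ?(lt_trans ltr01) //.
    by rewrite ler_weXn2l ?leq_addl // ltW.
  - rewrite /W divW_residual // (psum_eq0 _ q0) // mul0r subr0.
    have b0 : 0 < beta by apply: lt_trans b1.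
    rewrite m0 in nA dA.
    rewrite divr_ge0 ?(psum_ge0 _ b0 dA) // mulr_ge0 ?(psum_ge0 _ b0 nA) //.
    by rewrite exprn_ge0 // ltW.
have WB k : `|W k| <= K * P.
  rewrite -[W k](divfK (D0 k)) normrM ler_pM //; exact: psumP.
split; first exact: bounded_funP WB.
have -> : psum beta q = fun k =>
    (psum beta n (k.+1 + delta) - W k.+1 * beta ^- k.+1) / D k.+1.
  apply/funext => k; rewrite /W divW_residual // -/q -/(D k.+1); field.
  by rewrite D0 expf_neq0.
have Dcvg : (fun k => D k.+1) @ \oo --> value beta d.
  rewrite (cvg_shiftS D) (cvg_shiftn delta (psum beta d)).
  exact: (psum_cvg beta1 mM dA).
(* The lower bound [Dmin] passes to the limit. *)
have vd0 : value beta d != 0.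
  rewrite -normr_gt0; apply: lt_le_trans Dmin0 _.
  by apply: cvgr_to_ge (cvg_norm Dcvg) _; exact: nearW.
rewrite -[value beta n]subr0; apply: cvgM; last exact: cvgV.
apply: cvgB.
  rewrite (cvg_shiftS (fun k => psum beta n (k + delta))).
  rewrite (cvg_shiftn delta (psum beta n)); exact: (psum_cvg beta1 mM nA).
rewrite (cvg_shiftS (fun k => W k * beta ^- k)).
exact: (bounded_mul_expN_cvg0 beta1 WB).
Qed.

End OnLine.

Theorem theorem19 (R : realType) (beta : R) (m M : int)
  (hbeta : 1 < `|beta|)
  (hpos : 1 < beta -> m <= 0 /\ 0 < M)
  (hneg : beta < -1 -> m <= 0 /\ 0 <= M)
  (hcard : `|beta| < (M - m + 1)%:~R) :
  (exists (delta : nat) (SelectM : R -> int),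
     [/\ (1 <= delta)%N,
         (forall w : R, alphabet m M (SelectM w)) &
         forall x y : nat -> int,
           digit_seq m M x -> digit_seq m M y ->
           zero_upto delta x -> zero_upto delta y ->
           bounded_fun (mulW beta SelectM x y) /\
           psum beta (mulp beta SelectM x y) @ \oo -->
             value beta x * value beta y])
  /\
  (forall Dmin : R, 0 < Dmin ->
   exists (delta : nat) (SelectD : R -> R -> int),
     [/\ (1 <= delta)%N,
         (forall w D : R, alphabet m M (SelectD w D)) &
         forall n d : nat -> int,
           digit_seq m M n -> digit_seq m M d ->
           zero_upto delta n ->
           (forall k : nat, (1 <= k)%N -> Dmin <= `|psum beta d k|) ->
           bounded_fun (divW beta delta SelectD n d) /\
           psum beta (divq beta delta SelectD n d) @ \oo -->
             value beta n / value beta d]).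
Proof.
have mM : m <= 0 <= M.
  move: (hbeta); rewrite lter_normr => /orP[/hpos[-> /ltW]//|bN].
  by have [|-> ->] := hneg; first lra.
have [S [K [eps [e0 SA Sst]]]] :=
  stabilizing_selection hbeta hpos hneg hcard.
split=> [|Dmin Dmin0].
  have [delta [d1 dP]] := online_multiplication hbeta mM e0 Sst.
  by exists delta, S; split.
have [delta [d1 dP]] := online_division hbeta mM e0 SA Sst Dmin0.
by exists delta, (fun w D => S (w / D)); split.
Qed.
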